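(* Assume propositional truncations and function extensionality for $\mathbf{0}$-valued functions. Let $P,Q:\prod_{X:\mathcal{U}}X\to\mathcal{U}$ be invariant under equivalence, i.e. whenever there is an equivalence $X\to Y$ sending $x:X$ to $y:Y$, we have $P_X(x)\simeq P_Y(y)$ and $Q_X(x)\simeq Q_Y(y)$. Suppose that $P_Z(z)\vee Q_Z(z)$ for all $Z:\mathcal{U}$ and $z:Z$, and that there are types $X,Y:\mathcal{U}$ with points $x:X$, $y:Y$ such that $\neg P_X(x)$ and $\neg Q_Y(y)$. Suppose finally that either the type theory has pushouts, or the types $x=x$ and $y=y$ are propositions. Then weak excluded middle holds.
   Context: Work in intensional Martin-Löf type theory with $\Pi$-, $\Sigma$-, identity, finite types and natural numbers, and a universe $\mathcal{U}$ closed under these, extended with propositional truncations $\|A\|$ (universal proposition receiving a map from $A$). For propositions $A,B$, $A\vee B$ is $\|A+B\|$. $\neg A$ is $A\to\mathbf{0}$; $P_X$ abbreviates $P(X)$. A type is a proposition if any two elements are equal. Weak excluded middle: for all $A:\mathcal{U}$, $\neg A+\neg\neg A$. An equivalence is a map with a left and a right inverse; $A\simeq B$ means there is one. ''Pushouts'' means the type theory has (homotopy) pushouts of spans of types as higher inductive types. *)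

(* Defs.v *)
(* A shallow embedding of intensional Martin-Löf type theory: types are the
   elements of one fixed predicative universe [U] of Rocq, and finite types,
   sums and sigma types are the standard inductive types.  Identity types and
   negation are valued in [U] rather than in the impredicative [Prop]. *)

Definition U := Type.

Inductive Id {A : U} (a : A) : A -> U :=
| refl : Id a a.

Arguments refl {A a}, {A} a.

Definition neg (A : U) : U := A -> Empty_set.

Definition is_prop (A : U) : U := forall a b : A, Id a b.

Definition concat {A : U} {a b c : A} (p : Id a b) (q : Id b c) : Id a c :=
  match q in Id _ c' return Id a c' with refl => p end.

Definition ap {A B : U} (f : A -> B) {a b : A} (p : Id a b) : Id (f a) (f b) :=
  match p in Id _ b' return Id (f a) (f b') with refl => refl end.

Definition transport {A : U} (D : A -> U) {a b : A} (p : Id a b) : D a -> D b :=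
  match p in Id _ b' return D a -> D b' with refl => fun d => d end.

Definition apd {A : U} {D : A -> U} (s : forall a : A, D a) {a b : A}
    (p : Id a b) : Id (transport D p (s a)) (s b) :=
  match p in Id _ b' return Id (transport D p (s a)) (s b') with
  | refl => refl
  end.

Definition is_equiv {A B : U} (f : A -> B) : U :=
  ({g : B -> A & forall a : A, Id (g (f a)) a} *
   {h : B -> A & forall b : B, Id (f (h b)) b})%type.

Definition equiv (A B : U) : U := {f : A -> B & is_equiv f}.

Definition invariant (P : forall X : U, X -> U) : Type :=
  forall (X Y : U) (x : X) (y : Y) (e : X -> Y),
    is_equiv e -> Id (e x) y -> equiv (P X x) (P Y y).

Definition empty_funext : Type :=
  forall (A : U) (f g : A -> Empty_set),
    (forall a : A, Id (f a) (g a)) -> Id f g.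

(* Uniqueness of the factorization in [trunc_rec] is automatic, as [B] is a
   proposition. *)
Record prop_truncations : Type := {
  trunc : U -> U;
  tr : forall A : U, A -> trunc A;
  trunc_is_prop : forall A : U, is_prop (trunc A);
  trunc_rec : forall A B : U, is_prop B -> (A -> B) -> trunc A -> B
}.

Definition disj (T : prop_truncations) (A B : U) : U := trunc T (A + B)%type.

(* The homotopy pushout of [B <- A -> C] as a higher inductive type.  A
   hypothesis cannot impose judgmental equalities, so the computation rules on
   points are identities [po_ind_inl] and [po_ind_inr], and the rule on paths
   is stated modulo these. *)
Record pushout {A B C : U} (f : A -> B) (g : A -> C) : Type := {
  po : U;
  po_inl : B -> po;
  po_inr : C -> po;
  po_glue : forall a : A, Id (po_inl (f a)) (po_inr (g a));
  po_ind : forall (D : po -> U)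
    (dl : forall b : B, D (po_inl b))
    (dr : forall c : C, D (po_inr c))
    (dg : forall a : A, Id (transport D (po_glue a) (dl (f a))) (dr (g a)))
    (p : po), D p;
  po_ind_inl : forall D dl dr dg (b : B),
    Id (po_ind D dl dr dg (po_inl b)) (dl b);
  po_ind_inr : forall D dl dr dg (c : C),
    Id (po_ind D dl dr dg (po_inr c)) (dr c);
  po_ind_glue : forall D dl dr dg (a : A),
    Id (concat (apd (po_ind D dl dr dg) (po_glue a))
               (po_ind_inr D dl dr dg (g a)))
       (concat (ap (transport D (po_glue a)) (po_ind_inl D dl dr dg (f a)))
               (dg a))
}.

Definition has_pushouts : Type :=
  forall (A B C : U) (f : A -> B) (g : A -> C), pushout f g.

Definition weak_excluded_middle : Type :=
  forall A : U, (neg A + neg (neg A))%type.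

(* Main.v *)
(** Let [W * W'] be pointed by [(w, w')], where [W] is contractible if [~A] and
    pointed-equivalent to [X] if [~~A], while [W'] is contractible if [~~A] and
    pointed-equivalent to [Y] if [~A].  Then [P] at [W * W'] refutes [~~A] and
    [Q] at [W * W'] refutes [~A], and [~A + ~~A] is a proposition.  With
    pushouts, [W] is the join of [~A] and [X]; if [x = x] is a proposition,
    then [W] is the type of those [x'] for which [~~A] or [x = x'] holds.
    Likewise for [W']. *)

Require Import Defs.

Definition inv {A : U} {a b : A} (p : Id a b) : Id b a :=
  match p in Id _ b' return Id b' a with refl => refl end.

Lemma is_prop_of_center {A : U} (a : A) (h : forall b : A, Id a b) : is_prop A.
Proof. intros b c; exact (concat (inv (h b)) (h c)). Qed.

Lemma is_prop_neg (fe : empty_funext) (A : U) : is_prop (neg A).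
Proof. intros f g; apply fe; intro a; destruct (f a). Qed.

(** The summands are propositions that exclude each other, so the mixed cases are absurd. This lets
    a truncated disjunction be eliminated into the goal. *)
Lemma is_prop_neg_or_neg_neg (fe : empty_funext) (A : U) :
  is_prop (neg A + neg (neg A))%type.
Proof.
  intros [f | f] [g | g].
  - exact (ap inl (is_prop_neg fe A f g)).
  - destruct (g f).
  - destruct (f g).
  - exact (ap inr (is_prop_neg fe (neg A) f g)).
Qed.

Lemma is_prop_based_paths {A : U} {a : A} (h : is_prop (Id a a)) (b : A) :
  is_prop (Id a b).
Proof. intros p q; destruct q; apply h. Qed.

Lemma sigma_path {A : U} {D : A -> U} (hD : forall a : A, is_prop (D a))
    {a b : A} (p : Id a b) (s : D a) (t : D b) :
  Id (existT D a s) (existT D b t).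
Proof. destruct p; exact (ap (existT D a) (hD a s t)). Qed.

Lemma transport_paths {A : U} {a b c : A} (p : Id a b) (q : Id b c) :
  Id (transport (Id a) q p) (concat p q).
Proof. destruct q; exact refl. Qed.

Lemma concat_refl_l {A : U} {a b : A} (p : Id a b) : Id (concat refl p) p.
Proof. destruct p; exact refl. Qed.

Lemma is_equiv_of_inverse {A B : U} (f : A -> B) (g : B -> A)
    (gf : forall a : A, Id (g (f a)) a) (fg : forall b : B, Id (f (g b)) b) :
  is_equiv f.
Proof. split; exists g; assumption. Qed.

Lemma is_equiv_compose {A B C : U} (f : A -> B) (g : B -> C) :
  is_equiv f -> is_equiv g -> is_equiv (fun a => g (f a)).
Proof.
  intros [[l lf] [r fr]] [[l' lg] [r' gr]]; split.
  - exists (fun c => l (l' c)); intro a.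
    exact (concat (ap l (lg (f a))) (lf a)).
  - exists (fun c => r (r' c)); intro c.
    exact (concat (ap g (fr (r' c))) (gr c)).
Qed.

(** A proposition with a point [b] is contractible, so pairing with [b] inverts the projection. *)
Lemma is_equiv_fst {A B : U} (b : B) : is_prop B -> is_equiv (@fst A B).
Proof.
  intro hB; apply (is_equiv_of_inverse _ (fun a => (a, b))).
  - intros [a b']; exact (ap (pair a) (hB b b')).
  - intro a; exact refl.
Qed.

Lemma is_equiv_snd {A B : U} (a : A) : is_prop A -> is_equiv (@snd A B).
Proof.
  intro hA; apply (is_equiv_of_inverse _ (pair a)).
  - intros [a' b]; exact (ap (fun c => (c, b)) (hA a a')).
  - intro b; exact refl.
Qed.

Definition pointed_equiv (A : U) (a : A) (B : U) (b : B) : U :=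
  {e : A -> B & (is_equiv e * Id (e a) b)%type}.

Lemma pointed_equiv_fst {A B C : U} {a : A} {b : B} {c : C} :
  is_prop B -> pointed_equiv A a C c -> pointed_equiv (A * B)%type (a, b) C c.
Proof.
  intros hB [e [he ec]]; exists (fun z => e (fst z)); split.
  - exact (is_equiv_compose _ _ (is_equiv_fst b hB) he).
  - exact ec.
Qed.

Lemma pointed_equiv_snd {A B C : U} {a : A} {b : B} {c : C} :
  is_prop A -> pointed_equiv B b C c -> pointed_equiv (A * B)%type (a, b) C c.
Proof.
  intros hA [e [he ec]]; exists (fun z => e (snd z)); split.
  - exact (is_equiv_compose _ _ (is_equiv_snd a hA) he).
  - exact ec.
Qed.

Lemma invariant_map {P : forall X : U, X -> U} (P_inv : invariant P)
    {A B : U} {a : A} {b : B} :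
  pointed_equiv A a B b -> P A a -> P B b.
Proof. intros [e [he eb]]; exact (projT1 (P_inv A B a b e he eb)). Qed.

(** As [w] is a point of [W], [is_prop W] amounts to contractibility. Both clauses are implications,
    so that a single [W] serves without deciding [C]. *)
Definition collapse (C X : U) (x : X) : Type :=
  {W : U & {w : W &
    ((C -> is_prop W) * (neg C -> pointed_equiv W w X x))%type}}.

Section Join.

Context {C X : U} (J : pushout (@fst C X) (@snd C X)).

(** The centre is the image of [c]: it is joined to the other points of [C] by [hC] and to each
    point [x] of [X] by the glue at [(c, x)]. *)
Lemma is_prop_join (hC : is_prop C) (c : C) : is_prop (po _ _ J).
Proof.
  apply (is_prop_of_center (po_inl _ _ J c)).
  apply (po_ind _ _ J _ (fun c' => ap (po_inl _ _ J) (hC c c'))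
           (fun x => po_glue _ _ J (c, x))).
  intros [c' x]; cbn.
  (* Once [c'] is identified with [c], the coherence says that transporting [refl] along the glue at
     [(c, x)] yields that glue. *)
  destruct (hC c c').
  exact (concat (transport_paths _ _) (concat_refl_l _)).
Qed.

(** With [C] empty, [C * X] is empty too, so the pushout has only the points of [X] and no glue. All
    cases over [C] and [C * X] are vacuous, and the map to [X] defined by induction is inverse to
    [po_inr]. *)
Lemma pointed_equiv_join (nC : neg C) (x : X) :
  pointed_equiv (po _ _ J) (po_inr _ _ J x) X x.
Proof.
  pose (dl := fun c : C => match nC c return X with end).
  assert (dg : forall cx : C * X,
    Id (transport (fun _ => X) (po_glue _ _ J cx) (dl (fst cx))) (snd cx)).
  { intros [c x']; destruct (nC c). }
  exists (po_ind _ _ J (fun _ => X) dl (fun x' => x') dg); split.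
  - apply (is_equiv_of_inverse _ (po_inr _ _ J)).
    + apply (po_ind _ _ J
        (fun p => Id (po_inr _ _ J (po_ind _ _ J (fun _ => X) dl _ dg p)) p)
        (fun c => match nC c with end)
        (fun x' => ap (po_inr _ _ J) (po_ind_inr _ _ J _ _ _ _ x'))).
      intros [c x']; destruct (nC c).
    + exact (po_ind_inr _ _ J _ _ _ _).
  - exact (po_ind_inr _ _ J _ _ _ _ x).
Qed.

End Join.

Lemma collapse_of_pushouts (po : has_pushouts) (C X : U) (x : X) :
  is_prop C -> collapse C X x.
Proof.
  intro hC; pose (J := po _ _ _ (@fst C X) (@snd C X)).
  exists (Defs.po _ _ J), (po_inr _ _ J x); split.
  - exact (is_prop_join J hC).
  - intro nC; exact (pointed_equiv_join J nC x).
Qed.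

(** [W] is the subtype of [X] cut out by [D]. Under [neg C] the condition always holds, giving all
    of [X]; under [C] it leaves only the points equal to [x]. *)
Lemma collapse_of_prop_loops (T : prop_truncations) (C X : U) (x : X) :
  is_prop (Id x x) -> collapse C X x.
Proof.
  intro hx; pose (D := fun x' => disj T (neg C) (Id x x')).
  assert (hD : forall x', is_prop (D x')) by (intro; apply trunc_is_prop).
  exists {x' : X & D x'}, (existT D x (tr T _ (inr refl))); split.
  - intro c; apply (is_prop_of_center (existT D x (tr T _ (inr refl)))).
    intros [x' t]; apply (sigma_path hD).
    (* The hypothesis on loops makes [Id x x'] a proposition, so an actual path can be extracted
       from the truncated disjunction. *)
    apply (trunc_rec T _ _ (is_prop_based_paths hx x')) in t; [exact t |].
    intros [nC | p]; [destruct (nC c) | exact p].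
  - intro nC; exists (@projT1 X D); split.
    + apply (is_equiv_of_inverse _ (fun x' => existT D x' (tr T _ (inl nC)))).
      * intros [x' t]; exact (sigma_path hD refl _ _).
      * intro x'; exact refl.
    + exact refl.
Qed.

Theorem theorem2p12
  (T : prop_truncations)
  (fe : empty_funext)
  (P Q : forall X : U, X -> U)
  (P_inv : invariant P)
  (Q_inv : invariant Q)
  (PQ : forall (Z : U) (z : Z), disj T (P Z z) (Q Z z))
  (X Y : U) (x : X) (y : Y)
  (nPx : neg (P X x))
  (nQy : neg (Q Y y))
  (H : (has_pushouts + (is_prop (Id x x) * is_prop (Id y y)))%type) :
  weak_excluded_middle.
Proof.
  intro A.
  assert (WX : collapse (neg A) X x).
  { destruct H as [po | [hx _]].
    - exact (collapse_of_pushouts po _ _ _ (is_prop_neg fe A)).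
    - exact (collapse_of_prop_loops T _ _ _ hx). }
  assert (WY : collapse (neg (neg A)) Y y).
  { destruct H as [po | [_ hy]].
    - exact (collapse_of_pushouts po _ _ _ (is_prop_neg fe (neg A))).
    - exact (collapse_of_prop_loops T _ _ _ hy). }
  destruct WX as [W [w [W_prop W_equiv]]], WY as [W' [w' [W'_prop W'_equiv]]].
  apply (trunc_rec T _ _ (is_prop_neg_or_neg_neg fe A))
    with (2 := PQ (W * W')%type (w, w')).
  intros [p | q].
  - left; intro a; apply nPx.
    (* Now [W'] is contractible and [W] is equivalent to [X], so [p] transfers to [P X x]. *)
    assert (nnA : neg (neg A)) by exact (fun n => n a).
    exact (invariant_map P_inv
             (pointed_equiv_fst (W'_prop nnA) (W_equiv nnA)) p).
  - right; intro nA; apply nQy.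
    (* [W'] was built from [neg (neg A)], so its equivalence with [Y] asks for a triple negation,
       which [nA] supplies. *)
    exact (invariant_map Q_inv
             (pointed_equiv_snd (W_prop nA) (W'_equiv (fun n => n nA))) q).
Qed.
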